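(* Suppose $\pi^0(x)=\mathcal{Z}_{p,\lambda}^{-1}\exp(-\lambda|x|^p)$ for $x\in\mathbb{R}$, with $p,\lambda>0$ and $\mathcal{Z}_{p,\lambda}=\int_{\mathbb{R}}\exp(-\lambda|x|^p)\,dx$. Let $T=(\mathcal{P}^0)^{-1}\circ\Phi^0:\mathbb{R}\to\mathbb{R}$ be the increasing map pushing forward the standard Gaussian density to $\pi^0$. Then $$T(z)\sim\left(\frac{z^2}{2\lambda}\right)^{1/p},\qquad T'(z)\sim\frac{z}{\lambda p}\left(\frac{z^2}{2\lambda}\right)^{1/p-1}$$ when $z\to\infty$.
   Context: $\mathcal{P}^0(x)=\int_{-\infty}^x\pi^0(t)\,dt$ is the cumulative distribution function of $\pi^0$, and $\Phi^0(z)=\int_{-\infty}^z\frac{1}{\sqrt{2\pi}}e^{-t^2/2}\,dt$ is the standard Gaussian cumulative distribution function on $\mathbb{R}$. The notation $a(z)\sim b(z)$ when $z\to\infty$ means $a(z)/b(z)\to1$ as $z\to+\infty$. *)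

(* Defs.v *)
From mathcomp Require Import all_boot all_order all_algebra.
From mathcomp Require Import all_classical all_reals all_analysis.

Set Implicit Arguments.
Unset Strict Implicit.
Unset Printing Implicit Defensive.

Import Order.TTheory GRing.Theory Num.Theory.
Import numFieldNormedType.Exports.

Local Open Scope classical_set_scope.
Local Open Scope ring_scope.

(* [\int] below is the real-valued Lebesgue integral [Rintegral]. *)

Definition cdf_of_density (R : realType) (f : R -> R) (x : R) : R :=
  \int[@lebesgue_measure R]_(t in `]-oo, x]) f t.

Definition gauss_density (R : realType) (t : R) : R :=
  (Num.sqrt (2 * pi))^-1 * expR (- (t ^+ 2 / 2)).

Definition gauss_cdf (R : realType) : R -> R :=
  cdf_of_density (@gauss_density R).

Definition pexp_normalizer (R : realType) (p lam : R) : R :=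
  \int[@lebesgue_measure R]_(x in setT) expR (- (lam * `|x| `^ p)).

Definition pexp_density (R : realType) (p lam : R) (x : R) : R :=
  (pexp_normalizer p lam)^-1 * expR (- (lam * `|x| `^ p)).

Definition pexp_cdf (R : realType) (p lam : R) : R -> R :=
  cdf_of_density (pexp_density p lam).

(* ['pinv_(d) setT F] is the inverse of [F] on [range F] and equals [d] outside
   it; the default value 0 plays no role, since both distribution functions
   have range ]0, 1[ when p, lam > 0. *)
Definition transport_map (R : realType) (p lam : R) : R -> R :=
  'pinv_(fun=> 0) setT (pexp_cdf p lam) \o @gauss_cdf R.

Definition equivalent_at_infty (R : realType) (a b : R -> R) : Prop :=
  a z / b z @[z --> +oo] --> (1 : R).

(* Main.v *)
Require Import Defs.
From mathcomp Require Import all_boot all_order all_algebra.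
From mathcomp Require Import all_classical all_reals all_analysis.
From mathcomp Require Import measurable_realfun.
From mathcomp Require Import ring lra.

Import Order.TTheory GRing.Theory Num.Theory.
Import numFieldNormedType.Exports.

Set Implicit Arguments.
Unset Strict Implicit.

Local Open Scope classical_set_scope.
Local Open Scope ring_scope.

(* Both laws belong to the family with density [exp(- lam |x|^p) / Z]: the
   standard Gaussian is the case p = 2, lam = 1/2. For every member, L'Hopital's
   rule compares the tail [S_p = 1 - F_p] with [f_p(x) x^(1-p) / (lam p)]
   (Mills' ratio tends to 1), whence also [ln (S_p x) / x^p --> - lam].
   By definition of [T], [S_p (T z) = S_2 z]. Taking logarithms,
   [lam (T z)^p ~ z^2 / 2], which is the first equivalence; and
   [T' z = f_2 z / f_p (T z)], where the two Mills ratios turn the right-hand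
   side into [z (T z)^(1-p) / (lam p)], which gives the second one. *)

(** * Distribution functions of integrable densities *)

Lemma is_derive_cdf_of_density (R : realType) (f : R -> R) (x : R) :
  continuous f -> (@lebesgue_measure R).-integrable setT (EFin \o f) ->
  is_derive x 1 (cdf_of_density f) (f x).
Proof.
move=> cf intf.
(* The point [x + 1] is an arbitrary bound to the right of [x]: the fundamental theorem of calculus
   is applied at an interior point. *)
have [||||df dfE] := @continuous_FTC1 R f -oo%O x (x + 1).
- by rewrite ltrDl.
- exact: integrableS intf.
- by rewrite ltNyr.
- exact: cf.
by rewrite -dfE derive1E; exact/derivableP.
Qed.

(** Dominated convergence for [f] cut off to [A n], with [|f|] as dominating function: at each point
    the cut-off functions are eventually constant. With half-lines for [A n], and the line or the
    empty set for [B], it yields both limits of a distribution function. *)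
Lemma cvg_integral_restrict (R : realType) (f : R -> R) (A : (set R)^nat)
    (B : set R) :
  (@lebesgue_measure R).-integrable setT (EFin \o f) ->
  (forall n, measurable (A n)) -> measurable B ->
  (forall x, \forall n \near \oo, A n x <-> B x) ->
  \int[@lebesgue_measure R]_(t in A n) f t @[n --> \oo] -->
    \int[@lebesgue_measure R]_(t in B) f t.
Proof.
move=> intf mA mB AB.
have mf : measurable_fun [set: R] f.
  by case/integrableP : intf => /measurable_EFinP.
have mfP C : measurable C -> measurable_fun [set: R] (f \_ C).
  move=> mC; apply/(measurable_restrictT _ _).1 => //.
  exact: measurable_funTS.
have [|||||_ _ cv] := @dominated_convergence _ _ _ (@lebesgue_measure R) setT
  measurableT (fun n => EFin \o (f \_ (A n))) (EFin \o (f \_ B))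
  (fun x => `|(f x)%:E|%E).
- by move=> n; apply/measurable_EFinP; exact: (mfP _ (mA n)).
- apply/measurable_EFinP; exact: (mfP _ mB).
- apply: aeW => x _.
  apply: cvg_near_cst.
  have := AB x; apply: filterS => n ABx /=.
  congr EFin; rewrite !patchE.
  by congr (if _ then _ else _); apply/idP/idP; rewrite !inE => /ABx.
- exact: integrable_abse.
- apply: aeW => x n _ /=; rewrite patchE; case: ifP => // _.
  by rewrite normr0 lee_fin.
rewrite [X in _ --> X](_ : _ =
    fine (\int[lebesgue_measure]_x (EFin \o f \_ B) x)%E);
  last by rewrite Rintegral_mkcond.
rewrite (_ : (fun n => _) = fine \o
  (fun n => (\int[lebesgue_measure]_x (EFin \o f \_ (A n)) x)%E)); last first.
  by apply/funext => n; rewrite Rintegral_mkcond.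
apply: fine_cvg; rewrite fineK//.
apply: integrable_fin_num => //.
rewrite -restrict_EFin; apply/integrable_restrict => //.
by rewrite setTI; exact: integrableS intf.
Qed.

Lemma cvg_cdf_of_density_pinfty (R : realType) (f : R -> R) :
  (@lebesgue_measure R).-integrable setT (EFin \o f) ->
  cdf_of_density f x @[x --> +oo] -->
    \int[@lebesgue_measure R]_(t in setT) f t.
Proof.
(* Dominated convergence speaks of sequences, so the limit is tested along every sequence tending to
   [+oo]. *)
move=> intf; apply/cvg_pinftyP => u uoo; apply: cvg_integral_restrict => // x.
have /cvgryPge/(_ x) := uoo.
by apply: filterS => n xun; split => // _; rewrite /= in_itv.
Qed.

Lemma cvg_cdf_of_density_ninfty (R : realType) (f : R -> R) :
  (@lebesgue_measure R).-integrable setT (EFin \o f) ->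
  cdf_of_density f x @[x --> -oo] --> (0 : R).
Proof.
(* After the reflection [x] to [- x], the half-lines end at [- u n] and eventually miss any given
   point; the limit set is empty. *)
move=> intf; apply/cvgNy_compNP/cvg_pinftyP => u uoo /=.
rewrite -(Rintegral_set0 (@lebesgue_measure R) f).
apply: cvg_integral_restrict => // x.
have /cvgryPgt/(_ (- x)) := uoo.
apply: filterS => n xun; split => //; rewrite /= in_itv/= => xN.
by lra.
Qed.

(** * Functions on the line with limits at both ends *)

Lemma derive_gt0_increasing (R : realType) (F f : R -> R) :
  (forall x : R, is_derive x 1 F (f x)) -> (forall x, 0 < f x) ->
  {homo F : x y / x < y}.
Proof.
move=> dF f0 x y xy; have [|z _ FE] := MVT xy (fun z _ => dF z).
  by apply: derivable_within_continuous => z _; exact: ex_derive.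
by rewrite -subr_gt0 FE mulr_gt0// subr_gt0.
Qed.

(** Passing to the limit gives only weak bounds, so it is done at [x - 1] and [x + 1]; strict
    monotonicity then makes the bounds at [x] strict. *)
Lemma increasing_cvg_itv (R : realType) (F : R -> R) (a b : R) :
  {homo F : x y / x < y} -> F x @[x --> -oo] --> a -> F x @[x --> +oo] --> b ->
  forall x, a < F x < b.
Proof.
move=> Fi Fa Fb x; apply/andP; split.
- apply: (@le_lt_trans _ _ (F (x - 1))); last first.
    by apply: Fi; rewrite ltrBlDr ltrDl.
  apply: (@cvgr_to_le _ _ _ _ _ _ _ Fa); near=> y.
  by apply: ltW; apply: Fi; near: y; apply: nbhs_ninfty_lt; exact: num_real.
- apply: (@lt_le_trans _ _ (F (x + 1))); first by apply: Fi; rewrite ltrDl.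
  apply: (@cvgr_to_ge _ _ _ _ _ _ _ Fb); near=> y.
  by apply: ltW; apply: Fi; near: y; apply: nbhs_pinfty_gt; exact: num_real.
Unshelve. all: by end_near. Qed.

Lemma IVT_cvg_itv (R : realType) (F : R -> R) (a b y : R) :
  continuous F -> F x @[x --> -oo] --> a -> F x @[x --> +oo] --> b ->
  a < y < b -> exists x, F x = y.
Proof.
move=> cF Fa Fb /andP[ay yb].
have [u [_ Fu]] : exists u, u < 0 /\ F u < y.
  near (-oo : set_system R) => u; exists u; split; near: u.
    by apply: nbhs_ninfty_lt; exact: num_real.
  exact: (cvgr_lt _ Fa).
have [v [uv Fv]] : exists v, u < v /\ y < F v.
  near (+oo : set_system R) => v; exists v; split; near: v.
    by apply: nbhs_pinfty_gt; exact: num_real.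
  exact: (cvgr_gt _ Fb).
have [||c _ <-] := @IVT R F u v y (ltW uv).
- exact: continuous_subspaceT.
- by rewrite min_l ?max_r ?(ltW (lt_trans Fu Fv))// !ltW.
- by exists c.
Unshelve. all: by end_near. Qed.

(** * Real powers and logarithms *)

Lemma powRV (R : realType) (x r : R) : 0 <= x -> x^-1 `^ r = (x `^ r)^-1.
Proof.
by move=> x0; rewrite -[x^-1]powR_inv1// powRAC powR_inv1// powR_ge0.
Qed.

Lemma powR_cvgy (R : realType) (r : R) : 0 < r -> x `^ r @[x --> +oo] --> +oo.
Proof.
move=> r0; apply/cvgryPge => A; near=> x.
(* Truncating [A] at 0 makes the power [1 / r] followed by the power [r] the identity, which fails
   for a negative base. *)
have B0 : 0 <= Num.max A 0 by rewrite le_max lexx orbT.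
have x0 : 0 <= x by near: x; apply: nbhs_pinfty_ge; exact: num_real.
have : (Num.max A 0) `^ r^-1 <= x.
  by near: x; apply: nbhs_pinfty_ge; exact: num_real.
move=> /(ge0_ler_powR (ltW r0)); rewrite !nnegrE powR_ge0 => /(_ isT x0).
by rewrite -powRrM mulVf ?gt_eqF// powRr1// ge_max => /andP[].
Unshelve. all: by end_near. Qed.

Lemma powRN_cvg0 (R : realType) (r : R) : 0 < r ->
  x `^ (- r) @[x --> +oo] --> (0 : R).
Proof.
move=> r0; under eq_cvg do rewrite powRN.
apply: (iffRL (gtr0_cvgV0 (f := fun x : R => x `^ r) _)); last exact: powR_cvgy.
near=> x; apply: powR_gt0.
by near: x; apply: nbhs_pinfty_gt; exact: num_real.
Unshelve. all: by end_near. Qed.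

Lemma ln_powR_cvg0 (R : realType) (r : R) : 0 < r ->
  ln x / x `^ r @[x --> +oo] --> (0 : R).
Proof.
move=> r0; have r20 : 0 < r / 2 by rewrite divr_gt0.
apply: (@squeeze_cvgr _ _ _ _ (fun=> 0)
  (fun x => (r / 2)^-1 * x `^ (- (r / 2)))).
(* [ln x = (2 / r) ln (x^(r/2)) < (2 / r) x^(r/2)] *)
- near=> x.
  have x1 : 1 <= x by near: x; apply: nbhs_pinfty_ge; exact: num_real.
  have x0 : 0 < x by rewrite (lt_le_trans _ x1).
  rewrite divr_ge0 ?ln_ge0 ?powR_ge0//=.
  rewrite ler_pdivrMr ?powR_gt0// -mulrA -powRD; last first.
    by rewrite (gt_eqF x0) implybT.
  rewrite [_ + r](_ : _ = r / 2); last by field.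
  rewrite mulrC ler_pdivlMr// mulrC -ln_powR.
  by apply/ltW/ln_sublinear; rewrite powR_gt0.
- exact: cvg_cst.
- by rewrite -(mulr0 (r / 2)^-1); apply: cvgMr; exact: powRN_cvg0.
Unshelve. all: by end_near. Qed.

Lemma continuous_norm_powR (R : realType) (r : R) : 0 < r ->
  continuous (fun x : R => `|x| `^ r).
Proof.
move=> r0 x; have [->|x0] := eqVneq x 0.
  rewrite /continuous_at normr0 powR0 ?gt_eqF//.
  apply/cvgr0Pnorm_le => e e0; near=> y.
  rewrite ger0_norm ?powR_ge0//.
  (* At 0 the derivative of the power cannot be invoked, so continuity is checked directly with
     radius [e ^ (1 / r)]. *)
  have : `|y| <= e `^ r^-1.
    by near: y; apply: (@cvgr0_norm_le _ _ _ _ _ id cvg_id); rewrite powR_gt0.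
  move=> /(ge0_ler_powR (ltW r0)); rewrite !nnegrE powR_ge0 normr_ge0.
  by move=> /(_ isT isT); rewrite -powRrM mulVf ?gt_eqF// powRr1// ltW.
apply: (@continuous_comp _ _ _ (fun y : R => `|y|) (fun y => y `^ r)).
  exact: norm_continuous.
apply/differentiable_continuous/derivable1_diffP.
by apply: derivable_powR; rewrite in_itv/= andbT normr_gt0.
Unshelve. all: by end_near. Qed.

(** * L'Hopital's rule at infinity *)

(** The change of variable [x] to [1 / x] reduces this to the one-sided rule at 0; the factor
    [- 1 / x^2] of the chain rule cancels in the quotient of derivatives. *)
Lemma lhopital_at_pinfty (R : realType) (f df g dg : R -> R) (M l : R) :
  (forall x : R, M < x -> is_derive x 1 f (df x)) ->
  (forall x : R, M < x -> is_derive x 1 g (dg x)) ->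
  (forall x, M < x -> dg x != 0) ->
  f x @[x --> +oo] --> 0 -> g x @[x --> +oo] --> 0 ->
  df x / dg x @[x --> +oo] --> l -> f x / g x @[x --> +oo] --> l.
Proof.
move=> fdf gdg dg0 f0 g0 dfdg.
(* Chosen so that [0 < x < b] forces [M < 1 / x]; the maximum with 1 keeps [b] positive whatever the
   sign of [M]. *)
pose b : R := (Num.max M 1)^-1.
have b0 : 0 < b by rewrite invr_gt0 lt_max ltr01 orbT.
have invM x : x \in `]0, b[ -> 0 < x /\ M < x^-1.
  rewrite in_itv/= => /andP[x0 xb]; split=> //.
  move: xb; rewrite /b -[X in X < _]invrK ltf_pV2 ?posrE ?invr_gt0//.
    by rewrite gt_max => /andP[].
  by rewrite lt_max ltr01 orbT.
have dV (h dh : R -> R) : (forall x : R, M < x -> is_derive x 1 h (dh x)) ->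
    forall x, x \in `]0, b[ ->
    is_derive x 1 (h \o GRing.inv) (dh x^-1 * (- x ^- 2)).
  move=> hdh x /invM[x0 Mx]; apply: is_derive1_comp; first exact: hdh.
  rewrite -[X in is_derive _ _ _ X]mulr1.
  exact: (is_deriveV (f := id) (lt0r_neq0 x0)).
have cV : (x : R)^-1 @[x --> 0^'+] --> +oo.
  apply: (iffRL (cvgrVy (f := @id R) _)); last exact: cvg_at_right_filter.
  exact: nbhs_right_gt.
have cV' : (x : R)^-1 @[x --> +oo] --> 0^'+.
  move=> P [e /= e0 Pe].
  suff: \forall x \near +oo, P (x : R)^-1 by []; near=> x.
  have x0 : 0 < x by near: x; apply: nbhs_pinfty_gt; exact: num_real.
  apply: Pe => /=; last by rewrite invr_gt0.
  rewrite sub0r normrN gtr0_norm ?invr_gt0// invf_plt ?posrE//.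
  by near: x; apply: nbhs_pinfty_gt; exact: num_real.
have fg0 : (f \o GRing.inv) x / (g \o GRing.inv) x @[x --> 0^'+] --> l.
  apply: (lhopital_at_right b0 (dV _ _ fdf) (dV _ _ gdg)).
  - exact: cvg_comp cV f0.
  - exact: cvg_comp cV g0.
  - move=> x /invM[x0 Mx].
    by rewrite mulf_neq0 ?dg0// oppr_eq0 invr_eq0 expf_eq0/= gt_eqF.
  - have dfdgV : df x^-1 / dg x^-1 @[x --> 0^'+] --> l.
      exact: cvg_comp cV dfdg.
    apply: cvg_trans dfdgV; apply: near_eq_cvg; near=> x.
    have x0 : x != 0 by near: x; exact: nbhs_right_neq.
    by rewrite /= -mulf_div divff ?mulr1// oppr_eq0 invr_eq0 expf_eq0.
have fgV : (f \o GRing.inv) x^-1 / (g \o GRing.inv) x^-1 @[x --> +oo] --> l.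
  exact: cvg_comp cV' fg0.
apply: cvg_trans fgV; apply: near_eq_cvg; near=> x.
by rewrite /= invrK.
Unshelve. all: by end_near. Qed.

(** * Integrability of [exp(- lam |x|^p)] *)

(** This is the dominating function for the whole family; evenness reduces it to the half-line,
    where its integral is known. *)
Lemma integrable_oneDsqrV (R : realType) :
  (@lebesgue_measure R).-integrable setT (fun x => (oneDsqr x)^-1%:E).
Proof.
have moneDsqrV : measurable_fun [set: R] (fun x => (oneDsqr x)^-1).
  by apply: continuous_measurable_fun => x; exact: continuous_oneDsqrV.
apply/integrableP; split; first exact/measurable_EFinP.
have oneDsqr_ge0 x : 0 <= (oneDsqr x : R)^-1.
  by rewrite invr_ge0 (le_trans ler01 (oneDsqr_ge1 x)).
under eq_integral => x _ do rewrite /= ger0_norm//.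
rewrite ge0_symfun_integralT.
- rewrite (_ : [set x | _] = `[0, +oo[%classic); last first.
    by apply/seteqP; split => x/=; rewrite in_itv/= andbT.
  by rewrite integral0y_oneDsqr -EFinM ltry.
- by [].
- by move=> x; exact: continuous_oneDsqrV.
- by move=> x /=; rewrite /oneDsqr sqrrN.
Qed.

Lemma continuous_expRN_powR (R : realType) (p lam : R) : 0 < p ->
  continuous (fun x : R => expR (- (lam * `|x| `^ p))).
Proof.
move=> p0 x; apply: (@continuous_comp _ _ _ (fun x => - (lam * `|x| `^ p))).
  by apply: cvgN; apply: cvgMr; exact: continuous_norm_powR.
exact: continuous_expR.
Qed.

(* [exp y >= y^(n+1) / (n+1)!] with [n] such that [(n + 1) p >= 2]. *)
Lemma expRN_powR_le_oneDsqrV (R : realType) (p lam : R) :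
  0 < p -> 0 < lam ->
  exists C : R, forall x, expR (- (lam * `|x| `^ p)) <= C * (oneDsqr x)^-1.
Proof.
move=> p0 lam0; pose n := Num.truncn (2 / p).
pose k : R := lam ^+ n.+1 / n.+1`!%:R.
have k0 : 0 < k by rewrite divr_gt0 ?exprn_gt0// ltr0n fact_gt0.
(* With [y >= 0], the case [|x| <= 1] uses [1 + x^2 <= 2 <= 2 exp y]; otherwise [1 <= exp y] and the
   series bound [k x^2 <= exp y] are added. *)
exists (2 + k^-1) => x; set y := lam * _.
have y0 : 0 <= y by rewrite mulr_ge0 ?powR_ge0// ltW.
rewrite expRN ler_pdivlMr ?(lt_le_trans _ (oneDsqr_ge1 x))//.
rewrite mulrC ler_pdivrMr ?expR_gt0// /oneDsqr.
have ey1 : 1 <= expR y by rewrite -expR0 ler_expR.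
have k10 : 0 < k^-1 by rewrite invr_gt0.
have [x1|x1] := leP `|x| 1.
  have : x ^+ 2 <= 1 by rewrite -real_normK ?num_real// expr_le1.
  nra.
suff : k * x ^+ 2 <= expR y.
  move=> h; have : x ^+ 2 <= k^-1 * expR y by rewrite ler_pdivlMl.
  nra.
apply: le_trans (expR_ge1Dxn n y0); apply: ler_wpDl => //.
rewrite /k mulrAC ler_pM2r ?invr_gt0 ?ltr0n ?fact_gt0//.
rewrite exprMn ler_pM2l ?exprn_gt0//.
rewrite -real_normK ?num_real// -!powR_mulrn// ?powR_ge0// -powRrM.
apply: ler_powR; first exact: ltW.
by rewrite mulrC -ler_pdivrMr//; apply/ltW/truncnS_gt.
Qed.

Lemma integrable_expRN_powR (R : realType) (p lam : R) : 0 < p -> 0 < lam ->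
  (@lebesgue_measure R).-integrable setT
    (fun x => (expR (- (lam * `|x| `^ p)))%:E).
Proof.
move=> p0 lam0; have [C eC] := @expRN_powR_le_oneDsqrV R p lam p0 lam0.
apply: (@le_integrable _ _ _ (@lebesgue_measure R) _ measurableT _
  (fun x => (C * (oneDsqr x)^-1)%:E)).
- apply/measurable_EFinP; apply: continuous_measurable_fun.
  exact: continuous_expRN_powR.
- move=> x _ /=; rewrite lee_fin ger0_norm ?expR_ge0//.
  by rewrite (le_trans (eC x))// ler_norm.
- have := integrableZl measurableT C (@integrable_oneDsqrV R).
  by apply: eq_integrable => // x _; rewrite EFinM.
Qed.

(** * The densities of the family and their distribution functions *)

(** The primitive of [exp(- lam |x|^p)] increases strictly from 0 to the normalizer, so its value at
    0 lies strictly between them. *)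
Lemma pexp_normalizer_gt0 (R : realType) (p lam : R) : 0 < p -> 0 < lam ->
  0 < pexp_normalizer p lam.
Proof.
move=> p0 lam0; pose e (x : R) : R := expR (- (lam * `|x| `^ p)).
have inte : (@lebesgue_measure R).-integrable setT (EFin \o e).
  exact: integrable_expRN_powR.
have /andP[a b] := increasing_cvg_itv (derive_gt0_increasing
  (fun x => is_derive_cdf_of_density x (continuous_expRN_powR p0) inte)
  (fun x => expR_gt0 _)) (cvg_cdf_of_density_ninfty inte)
  (cvg_cdf_of_density_pinfty inte) 0.
exact: lt_trans a b.
Qed.

Lemma pexp_density_gt0 (R : realType) (p lam x : R) : 0 < p -> 0 < lam ->
  0 < pexp_density p lam x.
Proof.
by move=> p0 lam0; rewrite mulr_gt0 ?invr_gt0 ?pexp_normalizer_gt0 ?expR_gt0.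
Qed.

Lemma continuous_pexp_density (R : realType) (p lam : R) : 0 < p ->
  continuous (pexp_density p lam).
Proof. by move=> p0 x; apply: cvgMr; exact: continuous_expRN_powR. Qed.

Lemma integrable_pexp_density (R : realType) (p lam : R) : 0 < p -> 0 < lam ->
  (@lebesgue_measure R).-integrable setT (EFin \o pexp_density p lam).
Proof.
move=> p0 lam0.
have := integrableZl measurableT (pexp_normalizer p lam)^-1
  (integrable_expRN_powR p0 lam0).
by apply: eq_integrable => // x _; rewrite -EFinM.
Qed.

Lemma Rintegral_pexp_density (R : realType) (p lam : R) : 0 < p -> 0 < lam ->
  \int[@lebesgue_measure R]_(x in setT) pexp_density p lam x = 1.
Proof.
move=> p0 lam0; rewrite RintegralZl//; last exact: integrable_expRN_powR.
by rewrite mulVf// gt_eqF// pexp_normalizer_gt0.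
Qed.

Lemma is_derive_pexp_cdf (R : realType) (p lam x : R) : 0 < p -> 0 < lam ->
  is_derive x 1 (pexp_cdf p lam) (pexp_density p lam x).
Proof.
move=> p0 lam0; apply: is_derive_cdf_of_density.
  exact: continuous_pexp_density.
exact: integrable_pexp_density.
Qed.

Lemma continuous_pexp_cdf (R : realType) (p lam : R) : 0 < p -> 0 < lam ->
  continuous (pexp_cdf p lam).
Proof.
move=> p0 lam0 x; apply/differentiable_continuous/derivable1_diffP.
by have [] := is_derive_pexp_cdf x p0 lam0.
Qed.

Lemma pexp_cdf_increasing (R : realType) (p lam : R) : 0 < p -> 0 < lam ->
  {homo pexp_cdf p lam : x y / x < y}.
Proof.
move=> p0 lam0; apply: (@derive_gt0_increasing _ _ (pexp_density p lam)) => x.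
  exact: is_derive_pexp_cdf.
exact: pexp_density_gt0.
Qed.

Lemma cvg_pexp_cdf_ninfty (R : realType) (p lam : R) : 0 < p -> 0 < lam ->
  pexp_cdf p lam x @[x --> -oo] --> (0 : R).
Proof.
move=> p0 lam0; apply: cvg_cdf_of_density_ninfty.
exact: integrable_pexp_density.
Qed.

Lemma cvg_pexp_cdf_pinfty (R : realType) (p lam : R) : 0 < p -> 0 < lam ->
  pexp_cdf p lam x @[x --> +oo] --> (1 : R).
Proof.
move=> p0 lam0; rewrite -(Rintegral_pexp_density p0 lam0).
by apply: cvg_cdf_of_density_pinfty; exact: integrable_pexp_density.
Qed.

Lemma pexp_cdf_itv (R : realType) (p lam x : R) : 0 < p -> 0 < lam ->
  0 < pexp_cdf p lam x < 1.
Proof.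
move=> p0 lam0; apply: increasing_cvg_itv (pexp_cdf_increasing p0 lam0) _ _ x.
  exact: cvg_pexp_cdf_ninfty.
exact: cvg_pexp_cdf_pinfty.
Qed.

(** Only the constants need matching: the normal density has total mass 1, which forces
    [pexp_normalizer 2 2^-1] to be [sqrt (2 pi)]. *)
Lemma gauss_density_pexp (R : realType) :
  @gauss_density R = pexp_density 2 2^-1.
Proof.
have gE t : @gauss_density R t =
    (Num.sqrt (2 * pi))^-1 * expR (- (2^-1 * `|t| `^ 2)).
  rewrite /gauss_density powR_mulrn// real_normK ?num_real//.
  by rewrite [2^-1 * _]mulrC.
have /(congr1 fine) := @integral_normal_pdf R 0 1.
rewrite (_ : (fun x => (normal_pdf 0 1 x)%:E) =
  EFin \o @gauss_density R); last first.
  apply/funext => x; rewrite /= normal_pdfE ?oner_eq0//.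
  rewrite /normal_peak /normal_fun expr1n subr0 mul1r.
  by rewrite /gauss_density mulr_natl mulNr.
rewrite -/(\int[@lebesgue_measure R]_(x in setT) gauss_density x) /=.
under eq_Rintegral do rewrite gE.
rewrite RintegralZl//; last by apply: integrable_expRN_powR; rewrite ?invr_gt0.
rewrite -/(pexp_normalizer 2 2^-1) => /mulr1_eq h.
by apply/funext => x; rewrite gE /pexp_density -h invrK.
Qed.

(** * Mills' ratio and the logarithm of the tail *)

(** Continuity of the power at 1; it allows raising an asymptotic equivalence to a real power. *)
Lemma cvg_powR1 (R : realType) (T : Type) (F : set_system T) (FF : Filter F)
    (u : T -> R) (a : R) :
  u x @[x --> F] --> (1 : R) -> u x `^ a @[x --> F] --> (1 : R).
Proof.
move=> u1; have c1 : {for (1 : R), continuous (fun y : R => y `^ a)}.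
  apply/differentiable_continuous/derivable1_diffP.
  by apply: derivable_powR; rewrite in_itv/= andbT.
by move: c1; rewrite /prop_for /continuous_at powR1; exact: cvg_comp.
Qed.

Lemma is_derive_pexp_density (R : realType) (p lam x : R) : 0 < x ->
  is_derive x 1 (pexp_density p lam)
    (- (pexp_density p lam x * (lam * p * x `^ (p - 1)))).
Proof.
move=> x0.
pose d (y : R) := (pexp_normalizer p lam)^-1 * expR (- (lam * y `^ p)).
apply: (@near_eq_is_derive _ _ _ d).
  near=> y; rewrite /d /pexp_density gtr0_norm//.
  by near: y; exact: lt_nbhsr.
have dxp := is_derive1_powR p x0.
have dN : is_derive x 1 (fun y : R => - (lam * y `^ p))
    (- (lam * (p * x `^ (p - 1)))) := is_deriveN (is_deriveZ lam dxp).
have de := is_derive1_comp (x := x) (g := fun y : R => - (lam * y `^ p))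
  (is_derive_expR _) dN.
apply: (is_derive_eq (is_deriveZ (pexp_normalizer p lam)^-1 de)).
rewrite /pexp_density gtr0_norm// /GRing.scale/=.
by ring.
Unshelve. all: by end_near. Qed.

(* The leading term of the tail [1 - F], from an integration by parts. *)
Definition mills_approx (R : realType) (p lam x : R) : R :=
  (lam * p)^-1 * (pexp_density p lam x * x `^ (1 - p)).

(** The derivative is put in the form of [- pexp_density], the derivative of the tail, times a
    factor tending to 1: this is the quotient that L'Hopital's rule needs. *)
Lemma is_derive_mills_approx (R : realType) (p lam x : R) :
  0 < p -> 0 < lam -> 0 < x ->
  is_derive x 1 (mills_approx p lam)
    (- (pexp_density p lam x * (1 - (1 - p) / (lam * p) * x `^ (- p)))).
Proof.
move=> p0 lam0 x0.
have dM := is_deriveM (is_derive_pexp_density p lam x0)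
  (is_derive1_powR (1 - p) x0).
apply: (is_derive_eq (is_deriveZ (lam * p)^-1 dM)).
rewrite /GRing.scale/= (_ : 1 - p - 1 = - p); last by ring.
(* The power [1 - p] cancels the one produced by differentiating the exponential, leaving exactly
   [- f] as the leading term. *)
have x1 : x `^ (p - 1) * x `^ (1 - p) = 1.
  by rewrite -powRD ?(gt_eqF x0) ?implybT// addrC subrKA subrr powRr0.
have lp : lam * p != 0 by rewrite mulf_neq0 ?gt_eqF.
set f := pexp_density p lam x; set w := x `^ (- p).
transitivity ((lam * p)^-1 * (f * (1 - p) * w
    - f * (lam * p) * (x `^ (p - 1) * x `^ (1 - p)))).
  by ring.
rewrite x1; field.
by rewrite !gt_eqF.
Qed.

Lemma mills_approx_gt0 (R : realType) (p lam x : R) :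
  0 < p -> 0 < lam -> 0 < x -> 0 < mills_approx p lam x.
Proof.
move=> p0 lam0 x0.
apply: mulr_gt0; first by rewrite invr_gt0 mulr_gt0.
by apply: mulr_gt0; [exact: pexp_density_gt0|exact: powR_gt0].
Qed.

(** For [x >= 1], the exponential is at most [C / (1 + x^2)] and [x^(1-p) <= x], so their product is
    at most [C / x]. *)
Lemma cvg_mills_approx0 (R : realType) (p lam : R) : 0 < p -> 0 < lam ->
  mills_approx p lam x @[x --> +oo] --> (0 : R).
Proof.
move=> p0 lam0; have [C eC] := expRN_powR_le_oneDsqrV p0 lam0.
have Z0 := pexp_normalizer_gt0 p0 lam0.
pose K := (lam * p)^-1 * (pexp_normalizer p lam)^-1.
have K0 : 0 < K by rewrite mulr_gt0 ?invr_gt0 ?mulr_gt0.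
apply: (@squeeze_cvgr _ _ _ _ (fun=> 0) (fun x => K * C * x `^ (- 1))).
- near=> x.
  have x1 : 1 <= x by near: x; apply: nbhs_pinfty_ge; exact: num_real.
  have x0 : 0 < x by rewrite (lt_le_trans _ x1).
  rewrite ltW ?mills_approx_gt0//= /mills_approx.
  rewrite [leLHS](_ : _ = K * (expR (- (lam * `|x| `^ p)) * x `^ (1 - p))); last
     by rewrite /K /pexp_density !mulrA.
  rewrite -mulrA ler_pM2l//.
  have xp : x `^ (1 - p) <= x.
    rewrite -[leRHS]powRr1 ?(ltW x0)//; apply: ler_powR => //.
    by rewrite gerBl ltW.
  apply: (@le_trans _ _ (C * (oneDsqr x)^-1 * x)).
    by apply: ler_pM => //; rewrite ?expR_ge0 ?powR_ge0.
  have D0 : 0 < oneDsqr x := lt_le_trans ltr01 (oneDsqr_ge1 x).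
  have C0 : 0 <= C.
    have := le_trans (expR_ge0 _) (eC x).
    by rewrite pmulr_lge0// invr_gt0.
  rewrite -mulrA ler_wpM2l// powR_inv1 ?(ltW x0)// mulrC ler_pdivrMr//.
  rewrite mulrC ler_pdivlMr// /oneDsqr -expr2; lra.
- exact: cvg_cst.
- by rewrite -(mulr0 (K * C)); apply: cvgMr; exact: powRN_cvg0.
Unshelve. all: by end_near. Qed.

Lemma mills_ratio (R : realType) (p lam : R) : 0 < p -> 0 < lam ->
  (1 - pexp_cdf p lam x) / mills_approx p lam x @[x --> +oo] --> (1 : R).
Proof.
move=> p0 lam0; pose c := (1 - p) / (lam * p).
have v1 : 1 - c * x `^ (- p) @[x --> +oo] --> (1 : R).
  rewrite -[X in _ --> X]subr0 -(mulr0 c).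
  by apply: cvgB; [exact: cvg_cst|apply: cvgMr; exact: powRN_cvg0].
have [M [_ cM]] : \forall x \near +oo, 0 < 1 - c * x `^ (- p).
  by apply: (cvgr_gt _ v1).
(* Beyond [M] the derivative of the denominator does not vanish; beyond 0 the powers are
   differentiable. *)
pose N := Num.max M 0.
have N0 x : N < x -> 0 < x by rewrite gt_max => /andP[].
have NM x : N < x -> M < x by rewrite gt_max => /andP[].
apply: (@lhopital_at_pinfty _ _ (fun x => - pexp_density p lam x) _
  (fun x => - (pexp_density p lam x * (1 - c * x `^ (- p)))) N).
- move=> x _; apply: (is_derive_eq
    (is_deriveB (is_derive_cst (1 : R) x 1) (is_derive_pexp_cdf x p0 lam0))).
  by rewrite sub0r.
- by move=> x /N0 x0; exact: is_derive_mills_approx.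
- move=> x /NM /cM c0.
  by rewrite oppr_eq0 gt_eqF// mulr_gt0// pexp_density_gt0.
- rewrite -[X in _ --> X](subrr 1); apply: cvgB; first exact: cvg_cst.
  exact: cvg_pexp_cdf_pinfty.
- exact: cvg_mills_approx0.
- have vV : (1 - c * x `^ (- p))^-1 @[x --> +oo] --> (1 : R)^-1.
    exact: cvgV (oner_neq0 R) v1.
  rewrite invr1 in vV; apply: cvg_trans vV; apply: near_eq_cvg; near=> x.
  rewrite -[- (pexp_density _ _ _ * _)]mulNr invfM mulrA divff ?mul1r//.
  by rewrite oppr_eq0 gt_eqF// pexp_density_gt0.
Unshelve. all: by end_near. Qed.

(** The logarithm of the tail is that of Mills' ratio, which tends to 0, plus
    [K - lam x^p + (1 - p) ln x]; after division by [x^p] only [- lam] survives. *)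
Lemma ln_pexp_tail (R : realType) (p lam : R) : 0 < p -> 0 < lam ->
  ln (1 - pexp_cdf p lam x) / x `^ p @[x --> +oo] --> - lam.
Proof.
move=> p0 lam0.
have Z0 := pexp_normalizer_gt0 p0 lam0.
pose K := ln (lam * p)^-1 + ln (pexp_normalizer p lam)^-1.
have lnm : ln ((1 - pexp_cdf p lam x) / mills_approx p lam x)
    @[x --> +oo] --> (0 : R).
  have := continuous_ln (@ltr01 R); rewrite /prop_for /continuous_at ln1.
  exact: cvg_comp (mills_ratio p0 lam0).
have : (ln ((1 - pexp_cdf p lam x) / mills_approx p lam x) + K) * x `^ (- p)
    + (1 - p) * (ln x / x `^ p) - lam
    @[x --> +oo] --> (0 + K) * 0 + (1 - p) * 0 - lam.
  apply: cvgB; last exact: cvg_cst.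
  apply: cvgD; last by apply: cvgMr; exact: ln_powR_cvg0.
  apply: cvgM; last exact: powRN_cvg0.
  by apply: cvgD => //; exact: cvg_cst.
rewrite !mulr0 !add0r; apply: cvg_trans; apply: near_eq_cvg; near=> x.
have x0 : 0 < x by near: x; apply: nbhs_pinfty_gt; exact: num_real.
have S0 : 0 < 1 - pexp_cdf p lam x.
  by have /andP[_] := pexp_cdf_itv x p0 lam0; rewrite subr_gt0.
have m0 := mills_approx_gt0 p0 lam0 x0.
rewrite ln_div// powRN.
rewrite [ln (mills_approx _ _ _)](_ : _ =
    K - lam * x `^ p + (1 - p) * ln x); last first.
  rewrite /mills_approx /pexp_density gtr0_norm// -!mulrA.
  rewrite !lnM ?posrE ?mulr_gt0 ?invr_gt0 ?mulr_gt0 ?expR_gt0 ?powR_gt0//.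
  by rewrite expRK ln_powR /K; ring.
by field; rewrite gt_eqF// powR_gt0.
Unshelve. all: by end_near. Qed.

(** * The transport map *)

(** ['pinv_] is a right inverse only on the range; by the intermediate value theorem the range
    contains ]0, 1[, where the Gaussian values lie. *)
Lemma pexp_cdf_transport_map (R : realType) (p lam z : R) : 0 < p -> 0 < lam ->
  pexp_cdf p lam (transport_map p lam z) = pexp_cdf 2 2^-1 z.
Proof.
move=> p0 lam0; rewrite /transport_map /= /gauss_cdf gauss_density_pexp.
rewrite -/(pexp_cdf 2 2^-1); apply: pinvK; rewrite inE.
have [||||x Fx] := @IVT_cvg_itv R (pexp_cdf p lam) 0 1 (pexp_cdf 2 2^-1 z).
- exact: continuous_pexp_cdf.
- exact: cvg_pexp_cdf_ninfty.
- exact: cvg_pexp_cdf_pinfty.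
- by apply: pexp_cdf_itv; rewrite ?invr_gt0.
- by exists x.
Qed.

Lemma is_derive_transport_map (R : realType) (p lam z : R) : 0 < p -> 0 < lam ->
  is_derive z 1 (transport_map p lam)
    (pexp_density 2 2^-1 z / pexp_density p lam (transport_map p lam z)).
Proof.
move=> p0 lam0; set x := transport_map p lam z.
have FI := pexp_cdf_increasing p0 lam0.
have Finj : {in setT &, injective (pexp_cdf p lam)}.
  by move=> u v _ _; apply: inc_inj; apply: le_mono.
have dG : is_derive z 1 (@gauss_cdf R) (pexp_density 2 2^-1 z).
  rewrite /gauss_cdf gauss_density_pexp.
  by apply: is_derive_pexp_cdf; rewrite // invr_gt0.
have Gz : gauss_cdf z = pexp_cdf p lam x.
  by rewrite pexp_cdf_transport_map// /gauss_cdf gauss_density_pexp.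
have dFV : is_derive (gauss_cdf z) 1 ('pinv_(fun=> 0) setT (pexp_cdf p lam))
    (pexp_density p lam x)^-1.
  (* The inverse function rule applies at an image point, so the Gaussian value is first written as
     the image of [x]. *)
  rewrite Gz; apply: is_derive_inverse.
  - by near=> u; apply: pinvKV; rewrite ?inE.
  - by near=> u; exact: continuous_pexp_cdf.
  - exact: is_derive_pexp_cdf.
  - by rewrite gt_eqF// pexp_density_gt0.
by rewrite mulrC; exact: is_derive1_comp dFV dG.
Unshelve. all: by end_near. Qed.

(** For any [A], [pexp_cdf p lam A] is below 1 and is eventually exceeded by the Gaussian value;
    monotonicity carries this back to the arguments. *)
Lemma transport_map_cvgy (R : realType) (p lam : R) : 0 < p -> 0 < lam ->
  transport_map p lam z @[z --> +oo] --> +oo.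
Proof.
move=> p0 lam0; apply/cvgryPgt => A; near=> z.
have : pexp_cdf p lam A < pexp_cdf p lam (transport_map p lam z).
  rewrite pexp_cdf_transport_map//; near: z.
  have /andP[_ FA1] := pexp_cdf_itv A p0 lam0.
  by apply: (cvgr_gt _ (cvg_pexp_cdf_pinfty _ _)) => //; rewrite invr_gt0.
by rewrite (leW_mono (le_mono (pexp_cdf_increasing p0 lam0))).
Unshelve. all: by end_near. Qed.

(** Stated for the [p]-th power so that both equivalences follow from it, through the exponents
    [1 / p] and [1 / p - 1]. *)
Lemma transport_map_powR (R : realType) (p lam : R) : 0 < p -> 0 < lam ->
  transport_map p lam z `^ p / (z ^+ 2 / (2 * lam)) @[z --> +oo] --> (1 : R).
Proof.
move=> p0 lam0.
have lnT : ln (1 - pexp_cdf 2 2^-1 z) / transport_map p lam z `^ p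
    @[z --> +oo] --> - lam.
  under eq_cvg do rewrite -(pexp_cdf_transport_map _ p0 lam0).
  exact: cvg_comp (transport_map_cvgy p0 lam0) (ln_pexp_tail p0 lam0).
have lnG : ln (1 - pexp_cdf 2 2^-1 z) / z `^ 2 @[z --> +oo] --> - (2^-1 : R).
  by apply: ln_pexp_tail; rewrite // invr_gt0.
have lamN0 : - lam != 0 by rewrite oppr_eq0 gt_eqF.
(* The same logarithm is divided by [z^2] and by [(T z)^p]; in the quotient of the two limits it
   cancels, leaving [(T z)^p / z^2]. *)
have : (2 * lam) * ((ln (1 - pexp_cdf 2 2^-1 z) / z `^ 2) *
    (ln (1 - pexp_cdf 2 2^-1 z) / transport_map p lam z `^ p)^-1)
    @[z --> +oo] --> (2 * lam) * (- (2^-1) * (- lam)^-1).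
  by apply: cvgMr; apply: cvgM => //; exact: cvgV.
rewrite (_ : 2 * lam * _ = 1); last by field; rewrite gt_eqF.
apply: cvg_trans; apply: near_eq_cvg; near=> z.
have z0 : 0 < z by near: z; apply: nbhs_pinfty_gt; exact: num_real.
have T0 : 0 < transport_map p lam z.
  near: z; have /cvgryPgt := transport_map_cvgy p0 lam0; exact.
have S0 : ln (1 - pexp_cdf 2 2^-1 z) != 0.
  have /andP[G0 G1] : 0 < pexp_cdf 2 2^-1 z < 1.
    by apply: pexp_cdf_itv; rewrite ?invr_gt0.
  by rewrite lt_eqF// ln_lt0// subr_gt0 G1/= gtrBl.
rewrite powR_mulrn ?ltW//; field.
by rewrite S0 !gt_eqF// powR_gt0.
Unshelve. all: by end_near. Qed.

(** * The two equivalences *)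

Theorem lemmaA2 (R : realType) (p lam : R) (p_gt0 : 0 < p)
    (lam_gt0 : 0 < lam) :
  [/\ equivalent_at_infty (transport_map p lam)
        (fun z : R => (z ^+ 2 / (2 * lam)) `^ (1 / p)),
      (forall z : R, derivable (transport_map p lam) z 1)
    & equivalent_at_infty (derive1 (transport_map p lam))
        (fun z : R => z / (lam * p) * (z ^+ 2 / (2 * lam)) `^ (1 / p - 1))].
Proof.
have q1 := transport_map_powR p_gt0 lam_gt0.
have Toy := transport_map_cvgy p_gt0 lam_gt0.
have dT z := is_derive_transport_map z p_gt0 lam_gt0.
have Bgt0 (z : R) : 0 < z -> 0 < z ^+ 2 / (2 * lam).
  by move=> z0; rewrite divr_gt0 ?mulr_gt0 ?exprn_gt0.
split; last 1 first.
- have half0 : 0 < (2^-1 : R) by rewrite invr_gt0.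
  have m2 := mills_ratio (@ltr0n R 2) half0.
  have mT : (1 - pexp_cdf 2 2^-1 z) / mills_approx p lam (transport_map p lam z)
      @[z --> +oo] --> (1 : R).
    under eq_cvg do rewrite -(pexp_cdf_transport_map _ p_gt0 lam_gt0).
    exact: cvg_comp Toy (mills_ratio p_gt0 lam_gt0).
  (* The common tail [S_p (T z) = S_2 z] cancels in the ratio of
     Mills ratios. *)
  have : ((1 - pexp_cdf 2 2^-1 z) /
      mills_approx p lam (transport_map p lam z)) *
      ((1 - pexp_cdf 2 2^-1 z) / mills_approx 2 2^-1 z)^-1 *
      (transport_map p lam z `^ p / (z ^+ 2 / (2 * lam))) `^ (1 / p - 1)
      @[z --> +oo] --> (1 : R) * 1^-1 * 1.
    apply: cvgM; last exact: cvg_powR1.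
    by apply: cvgM => //; apply: cvgV.
  rewrite invr1 !mulr1; apply: cvg_trans; apply: near_eq_cvg; near=> z.
  have z0 : 0 < z by near: z; apply: nbhs_pinfty_gt; exact: num_real.
  have T0 : 0 < transport_map p lam z by near: z; have /cvgryPgt := Toy; exact.
  rewrite derive1E (@derive_val _ _ _ _ _ _ _ (dT z)).
  have S0 : 1 - pexp_cdf 2 2^-1 z != 0.
    have /andP[_ G1] : 0 < pexp_cdf 2 2^-1 z < 1 by exact: pexp_cdf_itv.
    by rewrite gt_eqF// subr_gt0.
  have f0 : pexp_density p lam (transport_map p lam z) != 0.
    by rewrite gt_eqF// pexp_density_gt0.
  have g0 : pexp_density 2 2^-1 z != 0 by rewrite gt_eqF// pexp_density_gt0.
  (* As [p (1 / p - 1) = 1 - p], the third factor cancels the power of [T z] in [mills_approx] and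
     brings in the power of [z^2 / (2 lam)]. *)
  rewrite powRM ?powR_ge0 ?invr_ge0 ?(ltW (Bgt0 _ _))//.
  rewrite powRV ?(ltW (Bgt0 _ _))//.
  rewrite -powRrM (_ : p * (1 / p - 1) = 1 - p); last by field; rewrite gt_eqF.
  (* For the Gaussian, [mills_approx] is the density over [z], whence the factor [z] of the
     equivalent. *)
  rewrite /mills_approx (_ : 1 - 2 = - 1); last by ring.
  rewrite powR_inv1 ?ltW//.
  have Tp0 : transport_map p lam z `^ (1 - p) != 0 by rewrite gt_eqF ?powR_gt0.
  have Bp0 : (z ^+ 2 / (2 * lam)) `^ (1 / p - 1) != 0.
    by rewrite gt_eqF ?powR_gt0 ?Bgt0.
  move: Tp0 Bp0 f0 g0 S0; set Tp := _ `^ (1 - p); set Bp := _ `^ (1 / p - 1).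
  set f := pexp_density p _ _; set g := pexp_density 2 _ _.
  set S := 1 - _ => Tp0 Bp0 f0 g0 S0.
  field.
  by rewrite Tp0 Bp0 f0 g0 S0 !gt_eqF.
- have q2 : (transport_map p lam z `^ p / (z ^+ 2 / (2 * lam))) `^ (1 / p)
      @[z --> +oo] --> (1 : R) by exact: cvg_powR1.
  apply: cvg_trans q2; apply: near_eq_cvg; near=> z.
  have z0 : 0 < z by near: z; apply: nbhs_pinfty_gt; exact: num_real.
  have T0 : 0 < transport_map p lam z by near: z; have /cvgryPgt := Toy; exact.
  rewrite powRM ?powR_ge0 ?invr_ge0 ?(ltW (Bgt0 _ _))//.
  rewrite powRV ?(ltW (Bgt0 _ _))//.
  by rewrite -powRrM div1r divff ?gt_eqF// powRr1 ?ltW.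
- by move=> z; have [] := dT z.
Unshelve. all: by end_near. Qed.
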